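(* For every number of candidates $m\ge 2$ and every $\beta\ge 1$, the utilitarian distortion of the Random Dictator rule under the Plackett–Luce model with parameter $\beta$ satisfies $$\mathcal{D}_{m,\beta}(\mathrm{RandomDictator})\;\le\; m\,e^{\beta}.$$
   Context: Setting. $C$ is a set of $m$ candidates and $\beta\ge 1$ is a real parameter. Let $\mathcal{V}$ be a probability distribution on $[0,1]^C$ (utility vectors). For each $n$, the utility vectors $\mathbf{u}_1,\dots,\mathbf{u}_n$ of $n$ voters are drawn i.i.d. from $\mathcal{V}$, with $u_{i,j}\in[0,1]$ the utility of voter $i$ for candidate $j$. Given the utilities, each voter $i$ independently submits a random ranking $\pi_i$ of $C$ drawn from the Plackett–Luce model: positions are filled from top to bottom, and at each step a candidate $j$ is chosen among the not yet ranked candidates with probability proportional to $e^{\beta u_{i,j}}$. A voting rule $f$ maps each profile $\pi^n=(\pi_1,\dots,\pi_n)$ (for every $n$) to a probability distribution over $C$. Put $\mathrm{Util}_j=\mathbb{E}_{\mathbf{u}\sim\mathcal{V}}[u_j]$ and $\mathrm{Util}_n(f)=\mathbb{E}\big[\tfrac1n\sum_{i=1}^n u_{i,f(\pi^n)}\big]$, the expectation being over utilities, rankings and the internal randomness of $f$. The utilitarian distortion is $$\mathcal{D}_{m,\beta}(f)=\sup_{\mathcal{V}}\ \limsup_{n\to\infty}\ \frac{\max_{j\in C}\mathrm{Util}_j}{\mathrm{Util}_n(f)},$$ with the ratio taken to be $1$ if numerator and denominator are both $0$. Random Dictator rule. Selects a voter uniformly at random and outputs that voter's top-ranked candidate; i.e.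 candidate $j$ is output with probability equal to the fraction of voters ranking $j$ first. *)

(* Defs.v *)
From HB Require Import structures.
From mathcomp Require Import all_boot all_order all_algebra all_fingroup.
From mathcomp Require Import all_classical all_reals all_analysis.
Set Implicit Arguments.
Unset Strict Implicit.
Unset Printing Implicit Defensive.
Import Order.TTheory GRing.Theory Num.Theory.
Import numFieldNormedType.Exports.
Local Open Scope classical_set_scope.
Local Open Scope ring_scope.

Record fdist (R : realType) (C : finType) := FDist {
  fdist_val :> C -> R;
  fdist_ge0 : forall j, 0 <= fdist_val j;
  fdist_sum1 : \sum_j fdist_val j = 1 }.

Section product_probability.
Context d (T : measurableType d) (R : realType).

Definition tuple_cons n (x : T * n.-tuple T) : n.+1.-tuple T :=
  [tuple of x.1 :: x.2].

Lemma measurable_tuple_cons n :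
  measurable_fun [set: T * n.-tuple T] (@tuple_cons n).
Proof. exact: measurable_cons. Qed.

HB.instance Definition _ n := isMeasurableFun.Build _ _ _ _
  (@tuple_cons n) (@measurable_tuple_cons n).

(* The law of n independent draws from P, i.e. the n-fold product of P. *)
Fixpoint iid (P : probability T R) (n : nat) : probability (n.-tuple T) R :=
  match n with
  | 0 => \d_([tuple] : 0.-tuple T)
  | k.+1 => distribution (P \x iid P k)%E (@tuple_cons k)
  end.

End product_probability.

(* Candidates are the elements of 'I_m.  A utility vector is an m-tuple of
   reals; a ranking is a permutation p, where p t is the candidate in position
   t, position 0 being the top. *)

Definition utility_cube (R : realType) (m : nat) : set (m.-tuple R) :=
  [set u | forall j : 'I_m, 0 <= tnth u j <= 1].

(* Position t receives candidate p t with probability proportional to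
   expR (beta * u_(p t)) among the candidates not placed before t, which are
   the p s with t <= s. *)
Definition plackett_luce (R : realType) (m : nat) (beta : R) (u : m.-tuple R)
    (p : {perm 'I_m}) : R :=
  \prod_(t < m) (expR (beta * tnth u (p t)) /
                 \sum_(s < m | (t <= s)%N) expR (beta * tnth u (p s))).

(* A profile has at least one voter: f n is the rule for n.+1 voters. *)
Definition voting_rule (R : realType) (m : nat) :=
  forall n : nat, n.+1.-tuple {perm 'I_m} -> fdist R 'I_m.

Section distortion.
Context (R : realType) (m : nat) (beta : R) (f : voting_rule R m).
Local Open Scope ereal_scope.

Definition util (V : probability (m.-tuple R) R) (j : 'I_m) : \bar R :=
  'E_V[fun u => tnth u j].

(* The expectation of the average utility of the winner over the rankings,
   which are independent given the utilities us, and over the lottery f. *)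
Definition cond_welfare (n : nat) (us : n.+1.-tuple (m.-tuple R)) : R :=
  (\sum_(pi : n.+1.-tuple {perm 'I_m})
     (\prod_(i < n.+1) plackett_luce beta (tnth us i) (tnth pi i)) *
     \sum_(j < m) f pi j *
       (n.+1%:R^-1 * \sum_(i < n.+1) tnth (tnth us i) j))%R.

Definition util_rule (V : probability (m.-tuple R) R) (n : nat) : \bar R :=
  'E_(iid V n.+1)[@cond_welfare n].

(* In \bar R, x / 0 = +oo for x > 0. *)
Definition util_ratio (x y : \bar R) : \bar R :=
  if (x == 0) && (y == 0) then 1 else x / y.

Definition distortion : \bar R :=
  ereal_sup [set limn_esup (fun n =>
      util_ratio (\big[maxe/-oo]_(j < m) util V j) (util_rule V n))
    | V in [set V : probability (m.-tuple R) R | V (@utility_cube R m) = 1]].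

End distortion.

Section random_dictator.
Context (R : realType) (m : nat) (m_gt0 : (0 < m)%N).

Definition top_choice (p : {perm 'I_m}) : 'I_m := p (Ordinal m_gt0).

Definition top_fraction n (pi : n.+1.-tuple {perm 'I_m}) (j : 'I_m) : R :=
  #|[set i : 'I_n.+1 | top_choice (tnth pi i) == j]%SET|%:R / n.+1%:R.

Lemma top_fraction_ge0 n (pi : n.+1.-tuple {perm 'I_m}) j :
  0 <= top_fraction pi j.
Proof. by rewrite divr_ge0. Qed.

Lemma top_fraction_sum1 n (pi : n.+1.-tuple {perm 'I_m}) :
  \sum_j top_fraction pi j = 1.
Proof.
rewrite -mulr_suml -natr_sum.
under eq_bigr do rewrite -sum1dep_card.
have <- : #|'I_n.+1| = \sum_j
    \sum_(i < n.+1 | top_choice (tnth pi i) == j) 1 :> nat.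
  by rewrite -sum1_card (partition_big (fun i => top_choice (tnth pi i)) xpredT).
by rewrite card_ord divff.
Qed.

Definition random_dictator : voting_rule R m := fun n pi =>
  FDist (top_fraction_ge0 pi) (top_fraction_sum1 pi).

End random_dictator.

(* Main.v *)
(** Under Plackett-Luce, voter i ranks j first with probability
    exp(beta u_ij) / sum_s exp(beta u_is), which on the unit cube is at least
    1 / (m exp beta) whatever the utilities are.  Given the utilities, Random
    Dictator therefore elects each candidate j with at least this probability,
    so the expected utility is at least Util_j / (m exp beta) for every n and
    every j, and no limit needs to be taken. *)

Require Import Defs.
From mathcomp Require Import all_boot all_order all_algebra all_fingroup.
From mathcomp Require Import all_classical all_reals all_analysis.
From mathcomp Require Import measurable_realfun.
Set Implicit Arguments.
Unset Strict Implicit.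
Unset Printing Implicit Defensive.
Import Order.TTheory GRing.Theory Num.Theory.
Local Open Scope classical_set_scope.
Local Open Scope ring_scope.

(** * Total mass and top-choice law of Plackett-Luce weights *)

Section choice_weights.
Context (R : numFieldType).

(** The Plackett-Luce formula for arbitrary weights. Inductions can then pass to the weights
    [w \o lift j] left once [j] is ranked; [w i = expR (beta * tnth u i)] gives back
    [plackett_luce]. *)
Definition ranking_weight n (w : 'I_n -> R) (p : {perm 'I_n}) : R :=
  \prod_(t < n) (w (p t) / \sum_(s < n | (t <= s)%N) w (p s)).

(** A ranking amounts to a top candidate and a ranking of the others. Injectivity suffices, since
    both sides have (n+1)! elements. *)
Lemma lift_perm_bij n :
  bijective (fun js : 'I_n.+1 * {perm 'I_n} => lift_perm ord0 js.1 js.2).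
Proof.
apply: inj_card_bij; last by rewrite card_prod card_ord !card_Sn factS.
move=> [j s] [k t] /= e.
have jk : j = k by rewrite -(lift_perm_id ord0 j s) e lift_perm_id.
rewrite -jk in e *; congr (_, _); apply/permP => i.
by apply: (@lift_inj _ j); rewrite -!(lift_perm_lift ord0) e.
Qed.

(** At position 0 the denominator runs over all candidates. Every later denominator omits position
    0, hence [j], so the other factors form the weight of [s]. *)
Lemma ranking_weight_lift n (w : 'I_n.+1 -> R) j (s : {perm 'I_n}) :
  ranking_weight w (lift_perm ord0 j s) =
  w j / (\sum_i w i) * ranking_weight (w \o lift j) s.
Proof.
rewrite /ranking_weight big_ord_recl lift_perm_id; congr (w j / _ * _).
  rewrite [RHS](reindex_inj (@perm_inj _ (lift_perm ord0 j s))).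
  exact: eq_bigl.
apply: eq_bigr => t _ /=; rewrite lift_perm_lift; congr (_ / _).
rewrite big_mkcond big_ord_recl /= add0r [RHS]big_mkcond /=.
by apply: eq_bigr => i _; rewrite lift_perm_lift.
Qed.

(** The predicate [Q] on the top candidate covers both uses: [xpredT] for the total mass, [pred1 j]
    for the law of the top choice. *)
Lemma sum_ranking_weight_lift n (w : 'I_n.+1 -> R) (Q : pred 'I_n.+1) :
  \sum_(p : {perm 'I_n.+1} | Q (p ord0)) ranking_weight w p =
  \sum_(j | Q j) w j / (\sum_i w i) *
    \sum_(s : {perm 'I_n}) ranking_weight (w \o lift j) s.
Proof.
under [RHS]eq_bigr do rewrite mulr_sumr.
rewrite pair_big /= (reindex _ (onW_bij _ (lift_perm_bij n))) /=.
apply: eq_big => [js|js _]; last exact: ranking_weight_lift.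
by rewrite lift_perm_id andbT.
Qed.

Lemma sum_ranking_weight n (w : 'I_n -> R) :
  (forall i, 0 < w i) -> \sum_p ranking_weight w p = 1.
Proof.
elim: n w => [|n IH] w w_gt0.
  rewrite (eq_bigr (fun=> 1)) => [|p _]; last first.
    by rewrite /ranking_weight big_ord0.
  by rewrite sumr_const card_Sn.
rewrite (sum_ranking_weight_lift w xpredT).
under eq_bigr => j _ do rewrite (IH (w \o lift j) (fun i => w_gt0 _)) mulr1.
rewrite -mulr_suml divff// gt_eqF// big_ord_recl ltr_wpDr// ?w_gt0//.
by rewrite sumr_ge0// => i _; exact: ltW.
Qed.

Lemma sum_ranking_weight_top n (w : 'I_n.+1 -> R) j :
  (forall i, 0 < w i) ->
  \sum_(p : {perm 'I_n.+1} | p ord0 == j) ranking_weight w p =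
  w j / \sum_i w i.
Proof.
move=> w_gt0; rewrite (sum_ranking_weight_lift w (pred1 j)) big_pred1_eq.
by rewrite sum_ranking_weight ?mulr1// => i; exact: w_gt0.
Qed.

End choice_weights.

(** * Marginals of a finite product distribution *)

Lemma tnth_ffun_bij (T : finType) n :
  bijective (fun g : {ffun 'I_n -> T} => [tuple g i | i < n]).
Proof.
exists (fun t : n.-tuple T => [ffun i => tnth t i]) => [g|t].
  by apply/ffunP => i; rewrite ffunE tnth_mktuple.
by apply: eq_from_tnth => i; rewrite tnth_mktuple ffunE.
Qed.

Lemma sum_prod_marginal (R : comPzRingType) (T : finType) n
    (a : 'I_n -> T -> R) (P : pred T) (i : 'I_n) :
  (forall k, \sum_x a k x = 1) ->
  \sum_(t : n.-tuple T | P (tnth t i)) \prod_k a k (tnth t k) =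
  \sum_(x | P x) a i x.
Proof.
move=> a1.
(* Setting the factor of index [i] to 0 outside [P] absorbs the constraint. The unconstrained sum of
   products is then a product of sums, all equal to 1 except the one at [i]. *)
pose b k x := if k == i then if P x then a k x else 0 else a k x.
transitivity (\sum_(t : n.-tuple T) \prod_k b k (tnth t k)).
  rewrite big_mkcond; apply: eq_bigr => t _; case: ifPn => Pt.
    by apply: eq_bigr => k _; rewrite /b; case: eqP => // ->; rewrite Pt.
  by rewrite (bigD1 i)//= /b eqxx (negbTE Pt) mul0r.
rewrite (reindex _ (onW_bij _ (tnth_ffun_bij T n))) /=.
under eq_bigr do under eq_bigr do rewrite tnth_mktuple.
rewrite -(bigA_distr_bigA b) (bigD1 i)//= [X in _ * X]big1 ?mulr1.
  by rewrite [RHS]big_mkcond; apply: eq_bigr => x _; rewrite /b eqxx.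
by move=> k /negbTE ki; rewrite -(a1 k); apply: eq_bigr => x _; rewrite /b ki.
Qed.

(** * Welfare of Random Dictator for fixed utilities *)

Section random_dictator_welfare.
Context (R : realType).

Definition softmax m (beta : R) (u : m.-tuple R) (j : 'I_m) : R :=
  expR (beta * tnth u j) / \sum_s expR (beta * tnth u s).

Lemma sum_plackett_luce m (beta : R) (u : m.-tuple R) :
  \sum_p plackett_luce beta u p = 1.
Proof.
apply: (@sum_ranking_weight _ _ (fun i => expR (beta * tnth u i))) => i.
exact: expR_gt0.
Qed.

Lemma sum_plackett_luce_top m (m_gt0 : (0 < m)%N) (beta : R) (u : m.-tuple R)
    j :
  \sum_(p | top_choice m_gt0 p == j) plackett_luce beta u p = softmax beta u j.
Proof.
case: m m_gt0 u j => // m m_gt0 u j.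
rewrite /top_choice (_ : Ordinal m_gt0 = ord0); last exact: val_inj.
apply: (@sum_ranking_weight_top _ _ (fun i => expR (beta * tnth u i))) => i.
exact: expR_gt0.
Qed.

(** On the cube the numerator is at least exp 0 = 1, and each of the [m] terms of the denominator is
    at most [expR beta]. *)
Lemma softmax_ge m (beta : R) (u : m.-tuple R) j :
  0 <= beta -> utility_cube u -> (m%:R * expR beta)^-1 <= softmax beta u j.
Proof.
move=> beta_ge0 u01.
have m_gt0 : 0 < m%:R :> R by rewrite ltr0n (leq_ltn_trans _ (ltn_ord j)).
have s_gt0 : 0 < \sum_s expR (beta * tnth u s).
  rewrite (bigD1 j)//= ltr_wpDr ?expR_gt0//.
  by rewrite sumr_ge0// => i _; exact: expR_ge0.
rewrite /softmax ler_pdivlMr// ler_pdivrMl ?mulr_gt0 ?expR_gt0//.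
apply: (@le_trans _ _ (m%:R * expR beta)); last first.
  rewrite ler_peMr ?mulr_ge0 ?expR_ge0// -expR0 ler_expR mulr_ge0//.
  by case/andP: (u01 j).
rewrite -[m in leRHS]card_ord mulr_natl -sumr_const ler_sum// => i _.
by rewrite ler_expR ler_piMr//; case/andP: (u01 i).
Qed.

(** The count of voters with top choice [j] is a sum of indicators, and each indicator only involves
    the marginal of a single voter. *)
Lemma expected_top_fraction m (m_gt0 : (0 < m)%N) (beta : R) n
    (us : n.+1.-tuple (m.-tuple R)) j :
  \sum_(pi : n.+1.-tuple {perm 'I_m})
    (\prod_i plackett_luce beta (tnth us i) (tnth pi i)) *
    top_fraction R m_gt0 pi j =
  n.+1%:R^-1 * \sum_i softmax beta (tnth us i) j.
Proof.
rewrite /top_fraction; under eq_bigr do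
  rewrite mulrA mulrC -sum1dep_card natr_sum mulr_sumr big_mkcond.
rewrite -mulr_sumr exchange_big /=; congr (_ * _); apply: eq_bigr => i _.
rewrite -(sum_plackett_luce_top m_gt0) -(sum_prod_marginal
  (a := fun i => plackett_luce beta (tnth us i))
  (fun p => top_choice m_gt0 p == j))//.
  by rewrite [RHS]big_mkcond; apply: eq_bigr => pi _; rewrite mulr1.
by move=> k; exact: sum_plackett_luce.
Qed.

Lemma cond_welfare_random_dictator m (m_gt0 : (0 < m)%N) (beta : R) n
    (us : n.+1.-tuple (m.-tuple R)) :
  cond_welfare beta (random_dictator R m_gt0) us =
  \sum_j (n.+1%:R^-1 * \sum_i softmax beta (tnth us i) j) *
    (n.+1%:R^-1 * \sum_i tnth (tnth us i) j).
Proof.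
rewrite /cond_welfare; under eq_bigr do rewrite mulr_sumr.
rewrite exchange_big; apply: eq_bigr => j _ /=.
rewrite -(expected_top_fraction m_gt0) mulr_suml.
by apply: eq_bigr => pi _; rewrite mulrA.
Qed.

Lemma cond_welfare_ge m (m_gt0 : (0 < m)%N) (beta : R) n
    (us : n.+1.-tuple (m.-tuple R)) j :
  0 <= beta -> (forall i, utility_cube (tnth us i)) ->
  (m%:R * expR beta)^-1 * (n.+1%:R^-1 * \sum_i tnth (tnth us i) j) <=
  cond_welfare beta (random_dictator R m_gt0) us.
Proof.
move=> beta_ge0 us01; rewrite cond_welfare_random_dictator.
have avg_ge0 k : 0 <= n.+1%:R^-1 * \sum_i tnth (tnth us i) k.
  rewrite mulr_ge0// sumr_ge0// => i _.
  by case/andP: (us01 i k).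
have share_ge k : (m%:R * expR beta)^-1 <=
    n.+1%:R^-1 * \sum_i softmax beta (tnth us i) k.
  rewrite ler_pdivlMl// mulrC mulr_natr -[n.+1 in leLHS]card_ord -sumr_const.
  by rewrite ler_sum// => i _; exact: softmax_ge.
(* Only the event that [j] wins is kept: the terms of the other winners are nonnegative. *)
rewrite (bigD1 j)//= ler_wpDr//; last by rewrite ler_wpM2r.
rewrite sumr_ge0// => k _; rewrite mulr_ge0// (le_trans _ (share_ge k))//.
Qed.

Lemma measurable_softmax m (beta : R) (j : 'I_m) :
  measurable_fun setT (fun u : m.-tuple R => softmax beta u j).
Proof.
have mexp k : measurable_fun setT
    (fun u : m.-tuple R => expR (beta * tnth u k)).
  apply: measurableT_comp => //; apply: measurable_funM => //.
  exact: measurable_tnth.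
(* The denominator S is positive, so 1 / S = exp (- ln S), a composition of measurable functions. *)
have -> : (fun u : m.-tuple R => softmax beta u j) = (fun u =>
    expR (beta * tnth u j) * expR (- ln (\sum_s expR (beta * tnth u s)))).
  apply/funext => u; rewrite /softmax expRN lnK// posrE (bigD1 j)//=.
  rewrite ltr_wpDr ?expR_gt0//.
  by rewrite sumr_ge0// => i _; exact: expR_ge0.
apply: measurable_funM => //; apply: measurableT_comp => //.
apply: measurableT_comp => //; apply: measurableT_comp => //.
exact: measurable_sum.
Qed.

Lemma measurable_avg m n (g : m.-tuple R -> R) :
  measurable_fun setT g ->
  measurable_fun setT (fun us : n.+1.-tuple (m.-tuple R) =>
    n.+1%:R^-1 * \sum_i g (tnth us i)).
Proof.
move=> mg; apply: measurable_funM => //; apply: measurable_sum => i.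
by apply: measurableT_comp => //; exact: measurable_tnth.
Qed.

Lemma measurable_cond_welfare m (m_gt0 : (0 < m)%N) (beta : R) n :
  measurable_fun setT
    (@cond_welfare R m beta (random_dictator R m_gt0) n).
Proof.
rewrite (_ : @cond_welfare _ _ _ _ n = fun us =>
  \sum_j (n.+1%:R^-1 * \sum_i softmax beta (tnth us i) j) *
    (n.+1%:R^-1 * \sum_i tnth (tnth us i) j)); last first.
  by apply/funext => us; exact: cond_welfare_random_dictator.
apply: measurable_sum => j; apply: measurable_funM.
  apply: (measurable_avg (g := fun u => softmax beta u j)).
  exact: measurable_softmax.
apply: (measurable_avg (g := fun u => tnth u j)); exact: measurable_tnth.
Qed.

End random_dictator_welfare.

(** * Coordinates of an i.i.d. sample *)

Section iid_marginals.
Context d (T : measurableType d) (R : realType) (P : probability T R).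
Local Open Scope ereal_scope.

(** By induction on [n]: through [tuple_cons], the preimage of [A] is a rectangle with one full
    side, of mass 1. The other side is [A] for the head and the induction hypothesis for the
    tail. *)
Lemma iid_marginal n (i : 'I_n) (A : set T) : measurable A ->
  iid P n ((fun t => tnth t i) @^-1` A) = P A.
Proof.
move=> mA; elim: n i => [[]//|n IH] i /=.
rewrite /distribution /pushforward /=.
case: (unliftP ord0 i) => [k ->|->].
  rewrite (_ : _ @^-1` _ = setT `*` ((fun t => tnth t k) @^-1` A)); last first.
    apply/seteqP; split => -[x t] /=; rewrite /tuple_cons tnthS//=.
    by case.
  rewrite product_measure1E//; last first.
    by rewrite -[X in measurable X]setTI; exact: measurable_tnth.
  rewrite [X in X * _](_ : _ = 1) ?mul1e; last exact: probability_setT.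
  exact: IH.
rewrite (_ : _ @^-1` _ = A `*` setT); last first.
  apply/seteqP; split => -[x t] /=; rewrite /tuple_cons tnth0//=.
  by case.
rewrite product_measure1E// [X in _ * X](_ : _ = 1) ?mule1//.
exact: probability_setT.
Qed.

Lemma iid_ae n (A : set T) : measurable A -> P A = 1 ->
  {ae iid P n, forall t, forall i, A (tnth t i)}.
Proof.
move=> mA PA; apply: filter_forall => i.
have mAi : measurable ((fun t : n.-tuple T => tnth t i) @^-1` A).
  by rewrite -[X in measurable X]setTI; exact: measurable_tnth.
exists (~` ((fun t : n.-tuple T => tnth t i) @^-1` A)); split => //.
  exact: measurableC.
by rewrite probability_setC// iid_marginal// PA subee.
Qed.

Lemma ge0_expectation_iid n (g : T -> R) (i : 'I_n) :
  measurable_fun setT g -> (forall x, (0 <= g x)%R) ->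
  'E_(iid P n)[fun t => g (tnth t i)] = 'E_P[g].
Proof.
move=> mg g0; rewrite !unlock.
(* [P] is the image of [iid P n] under the [i]-th coordinate, so this is a change of variables;
   nonnegativity of [g] replaces integrability. *)
rewrite [RHS](eq_measure_integral (pushforward (iid P n) (fun t => tnth t i))).
- exact: measurable_tnth.
- move=> mtnth; rewrite (ge0_integral_pushforward mtnth)//.
    exact/measurable_EFinP.
  by move=> x _; rewrite lee_fin.
- move=> mtnth A mA _; exact/esym/iid_marginal.
Qed.

Lemma ge0_expectation_iid_avg n (g : T -> R) :
  measurable_fun setT g -> (forall x, (0 <= g x)%R) ->
  'E_(iid P n.+1)[fun t => (n.+1%:R^-1 * \sum_i g (tnth t i))%R] = 'E_P[g].
Proof.
move=> mg g0; rewrite unlock.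
have mgi (i : 'I_n.+1) :
    measurable_fun setT (fun t : n.+1.-tuple T => (g (tnth t i))%:E).
  apply/measurable_EFinP; apply: measurableT_comp => //.
  exact: measurable_tnth.
under eq_integral do rewrite EFinM -sumEFin.
rewrite ge0_integralZl//; last first.
- by move=> t _; rewrite sume_ge0// => i _; rewrite lee_fin.
- exact: emeasurable_sum.
rewrite ge0_integral_sum//; last by move=> i t _; rewrite lee_fin.
under eq_bigr => i _.
  rewrite (_ : integral _ _ _ = 'E_P[g]); first over.
  by rewrite -(ge0_expectation_iid i mg g0) unlock.
rewrite sumr_const card_ord [X in _ * X](_ : _ = n.+1%:R%:E * 'E_P[g]).
  by rewrite muleA -EFinM mulVf// mul1e unlock.
by rewrite mule_natl.
Qed.

End iid_marginals.

(** * From the pointwise bound to expectations and the distortion *)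

Section random_dictator_distortion.
Context (R : realType).

Lemma measurable_utility_cube m : measurable (@utility_cube R m).
Proof.
rewrite (_ : @utility_cube R m = \bigcap_(j in [set: 'I_m])
    ((fun u : m.-tuple R => tnth u j) @^-1` `[0, 1])).
  apply: fin_bigcap_measurable => // j _.
  by rewrite -[X in measurable X]setTI; exact: measurable_tnth.
apply/seteqP; split => u u01 j => [_ /=|].
  by rewrite in_itv; exact: u01.
by have := u01 j I; rewrite /= in_itv.
Qed.

Lemma expectation_ae d (T : measurableType d) (P : probability T R)
    (X Y : T -> R) : measurable_fun setT X -> measurable_fun setT Y ->
  {ae P, forall x, X x = Y x} -> ('E_P[X] = 'E_P[Y])%E.
Proof.
move=> mX mY XY; rewrite unlock; apply: ae_eq_integral => //.
- exact/measurable_EFinP.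
- exact/measurable_EFinP.
- by apply: filterS XY => x -> _.
Qed.

Local Open Scope ereal_scope.

Section fixed_law.
Context m (m_gt0 : (0 < m)%N) (beta : R) (beta_ge0 : (0 <= beta)%R).
Context (V : probability (m.-tuple R) R) (V_cube : V (@utility_cube R m) = 1).

(** [V] is concentrated on the cube, where utilities are nonnegative. With the norm the integrand is
    nonnegative everywhere, as the expectation lemmas require. *)
Lemma util_normE j : util V j = 'E_V[fun u => `|tnth u j|%R].
Proof.
apply: expectation_ae; first exact: measurable_tnth.
  by apply: measurableT_comp => //; exact: measurable_tnth.
exists (~` @utility_cube R m); split.
- by apply: measurableC; exact: measurable_utility_cube.
- by rewrite probability_setC ?V_cube ?subee//; exact: measurable_utility_cube.
- move=> u /= uj u01; apply: uj; rewrite ger0_norm//.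
  by case/andP: (u01 j).
Qed.

Lemma util_ge0 j : 0 <= util V j.
Proof. by rewrite util_normE; exact: expectation_ge0. Qed.

(* The norms extend the bound of [cond_welfare_ge], valid on the cube only, to
   nonnegative functions on the whole space. *)
Lemma util_rule_random_dictator_ge n j :
  ((m%:R * expR beta)^-1)%:E * util V j <=
  util_rule beta (random_dictator R m_gt0) V n.
Proof.
set c := ((m%:R * expR beta)^-1)%R.
have c_ge0 : (0 <= c)%R by rewrite invr_ge0 mulr_ge0// expR_ge0.
have mnorm : measurable_fun setT (fun u : m.-tuple R => `|tnth u j|%R).
  by apply: measurableT_comp => //; exact: measurable_tnth.
have cnorm_ge0 (u : m.-tuple R) : (0 <= c * `|tnth u j|)%R by rewrite mulr_ge0.
have mcnorm : measurable_fun setT (fun u : m.-tuple R => c * `|tnth u j|)%R.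
  exact: measurable_funM.
have mwelfare := @measurable_cond_welfare R m m_gt0 beta n.
have us01 := iid_ae n.+1 (measurable_utility_cube (m := m)) V_cube.
have ge_avg (us : n.+1.-tuple (m.-tuple R)) :
    (forall i, utility_cube (tnth us i)) ->
    (0 <= n.+1%:R^-1 * \sum_i c * `|tnth (tnth us i) j| <=
      cond_welfare beta (random_dictator R m_gt0) us)%R.
  move=> us01'; apply/andP; split; first by rewrite mulr_ge0// sumr_ge0.
  apply: le_trans (cond_welfare_ge m_gt0 j beta_ge0 us01').
  rewrite -mulr_sumr mulrCA ler_wpM2l// ler_wpM2l// ler_sum// => i _.
  by rewrite ger0_norm//; case/andP: (us01' i j).
rewrite util_normE.
have -> : c%:E * 'E_V[fun u => `|tnth u j|%R] =
    'E_V[fun u => (c * `|tnth u j|)%R].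
  rewrite unlock -ge0_integralZl//; exact/measurable_EFinP.
rewrite -(ge0_expectation_iid_avg V n mcnorm cnorm_ge0).
rewrite /util_rule [leRHS](expectation_ae (Y := fun us =>
  `|cond_welfare beta (random_dictator R m_gt0) us|%R))//.
- apply: expectation_le => //.
  + exact: (@measurable_avg _ _ _ _ mcnorm).
  + exact: measurableT_comp.
  + by move=> us; rewrite mulr_ge0// sumr_ge0.
  + apply: filterS us01 => us /ge_avg/andP[_] /le_trans; apply.
    exact: ler_norm.
- exact: measurableT_comp.
- apply: filterS us01 => us /ge_avg/andP[avg_ge0 le_avg].
  by rewrite ger0_norm// (le_trans avg_ge0).
Qed.

End fixed_law.

(** If [y = 0] then [x = 0] and the ratio is 1 by convention, whence [1 <= K]; if [y] is infinite
    the quotient is 0; otherwise one divides by [y]. *)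
Lemma util_ratio_le (K : R) (x y : \bar R) : (1 <= K)%R ->
  0 <= x -> 0 <= y -> x <= K%:E * y -> util_ratio x y <= K%:E.
Proof.
move=> K1 x0 y0 xKy; have K0 : (0 < K)%R by exact: lt_le_trans K1.
rewrite /util_ratio; have [ye0|yn0] := eqVneq y 0.
  rewrite ye0 mule0 in xKy.
  by rewrite (_ : x == 0) /=; [rewrite lee_fin|rewrite eq_le xKy x0].
rewrite andbF; case: y y0 yn0 xKy => [r|_ _ _|//].
  rewrite lee_fin eqe => r0 rn0 xKr.
  have r_gt0 : (0 < r)%R by rewrite lt_neqAle eq_sym rn0 r0.
  by rewrite inver (negbTE rn0) lee_pdivrMr.
by rewrite /inve mule0 lee_fin ltW.
Qed.

(** The upper limit is an infimum of suprema over the sets of the filter; the whole index set is one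
    of them. *)
Lemma limn_esup_le (u : nat -> \bar R) (l : \bar R) :
  (forall n, u n <= l) -> limn_esup u <= l.
Proof.
move=> ul; rewrite /limn_esup limf_esupE; apply: ge_ereal_inf.
exists (ereal_sup (range u)); first by exists setT => //; exact: filterT.
by apply: ge_ereal_sup => _ [n _ <-].
Qed.

End random_dictator_distortion.

Theorem theorem3p1 (R : realType) (m : nat) (m_ge2 : (2 <= m)%N)
    (beta : R) (beta_ge1 : 1 <= beta) :
  (distortion beta (random_dictator R (ltnW m_ge2)) <=
   (m%:R * expR beta)%:E)%E.
Proof.
have beta_ge0 : 0 <= beta by exact: le_trans beta_ge1.
have m_gt0 : 0 < m%:R :> R by rewrite ltr0n ltnW.
have K_gt0 : 0 < m%:R * expR beta by rewrite mulr_gt0// expR_gt0.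
apply: ge_ereal_sup => _ [V V_cube <-]; apply: limn_esup_le => n.
(* Any candidate would do: its utility is nonnegative, which makes both the welfare of the rule and
   the maximum over candidates nonnegative. *)
pose j0 := Ordinal (ltnW m_ge2).
have util_le j : (util V j <=
    (m%:R * expR beta)%:E *
      util_rule beta (random_dictator R (ltnW m_ge2)) V n)%E.
  by rewrite -lee_pdivrMl//; exact: util_rule_random_dictator_ge.
have rule_ge0 : (0 <= util_rule beta (random_dictator R (ltnW m_ge2)) V n)%E.
  apply: le_trans (util_rule_random_dictator_ge _ _ V_cube n j0) => //.
  by rewrite mule_ge0 ?util_ge0// lee_fin invr_ge0 ltW.
apply: util_ratio_le => //.
- apply: mulr_ege1; first by rewrite ler1n ltnW.
  by rewrite -expR0 ler_expR.
- exact: le_trans (util_ge0 V_cube j0) (le_bigmax _ _ _).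
- by apply: bigmax_le => //; exact: leNye.
Qed.
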